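(* Let $A$ be a commutative ring with unity with a semi-transition map $\psi:A\to\mathcal{P}(\Lambda)$, let $S=\{a\in A\mid\psi(a)=\emptyset\}$, $A_S=S^{-1}A$, and let $\varphi:A_S\to\mathcal{P}(\Lambda)$, $\varphi(a/t)=\psi(a)$, be the associated semi-transition map. Then: (a) If $M$ is a maximal ideal in $A_S$, then $\varphi[M]=\{\varphi(a)\mid a\in M\}$ is a $\varphi$-ultrafilter on $\Lambda$. (b) If $\mathscr{A}$ is a $\varphi$-ultrafilter on $\Lambda$, then $\varphi^{-1}[\mathscr{A}]=\{a\in A_S\mid\varphi(a)\in\mathscr{A}\}$ is a maximal ideal in $A_S$. Moreover, the mapping $M\mapsto\varphi[M]$ is one-one from the set of all maximal ideals in $A_S$ onto the set of all $\varphi$-ultrafilters on $\Lambda$.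
   Context: All rings are commutative with unity. $\mathcal{P}(\Lambda)$ is the power set of $\Lambda$. For a ring $A$ and a nonempty set $\Lambda$, a map $\psi:A\to\mathcal{P}(\Lambda)$ is a semi-transition map on $A$ if: (i) $\psi(ab)=\psi(a)\cup\psi(b)$ for all $a,b\in A$; (ii) $\psi(1)=\emptyset$, and $\psi(a)=\Lambda$ if and only if $a=0$; (iii) for all $a,b\in A$ there is some $c$ in the ideal $(a,b)$ with $\psi(a)\cap\psi(b)=\psi(c)\subseteq\psi(a+b)$; moreover, if $\psi(a)\cap\psi(b)=\emptyset$, then the ideal $(a^m,b^n)$ is principal for some $m,n\in\mathbb{N}$ (positive integers). The set $S$ is multiplicatively closed, and the map $\varphi(a/t)=\psi(a)$ is well defined and is a semi-transition map on $A_S$. Write $\varphi(A_S)=\{\varphi(a)\mid a\in A_S\}$. A $\varphi$-filter on $\Lambda$ is a nonempty subfamily $\mathscr{F}$ of $\varphi(A_S)$ such that (i) $\emptyset\notin\mathscr{F}$; (ii) if $\varphi(a),\varphi(b)\in\mathscr{F}$ then $\varphi(a)\cap\varphi(b)\in\mathscr{F}$; (iii) if $\varphi(a)\in\mathscr{F}$, $\varphi(c)\in\varphi(A_S)$ and $\varphi(a)\subseteq\varphi(c)$, then $\varphi(c)\in\mathscr{F}$. A $\varphi$-ultrafilter is a maximal $\varphi$-filter (one not properly contained in any other $\varphi$-filter). *)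

(* Defs.v *)
From HB Require Import structures.
From mathcomp Require Import all_boot all_algebra ring.
From mathcomp Require Import all_classical.

Set Implicit Arguments.
Unset Strict Implicit.
Unset Printing Implicit Defensive.

Import GRing.Theory.
Local Open Scope quotient_scope.
Local Open Scope classical_set_scope.
Local Open Scope ring_scope.

Section Localization.
Variables (A : comPzRingType) (S : mulrClosed A).

Definition preloc : Type := (A * {t : A | t \in S})%type.

Implicit Types x y z : preloc.

Local Notation num x := (x.1 : A).
Local Notation den x := (sval x.2 : A).

(* The factor u is needed since A may have zero divisors. *)
Definition loc_equiv x y : bool :=
  `[< exists2 u, u \in S & u * (num x * den y) = u * (num y * den x) >].

Lemma denP x : den x \in S. Proof. exact: valP. Qed.

Lemma loc_equiv_refl : reflexive loc_equiv.
Proof. by move=> x; apply/asboolP; exists 1; rewrite ?rpred1. Qed.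

Lemma loc_equiv_sym : symmetric loc_equiv.
Proof.
by move=> x y; apply/asboolP/asboolP => -[u uS e]; exists u.
Qed.

Lemma loc_equiv_trans : transitive loc_equiv.
Proof.
move=> y x z /asboolP[u uS e] /asboolP[v vS f]; apply/asboolP.
exists (u * v * den y); first by rewrite !rpredM ?denP.
transitivity (v * den z * (u * (num x * den y))); first by ring.
rewrite e; transitivity (u * den x * (v * (num y * den z))); first by ring.
by rewrite f; ring.
Qed.

Canonical loc_equivr :=
  EquivRel loc_equiv loc_equiv_refl loc_equiv_sym loc_equiv_trans.

Definition loc := {eq_quot loc_equiv}.
HB.instance Definition _ : EqQuotient _ loc_equiv loc := EqQuotient.on loc.
HB.instance Definition _ := Choice.on loc.

Definition denM x y : {t : A | t \in S} :=
  exist _ (den x * den y) (rpredM (denP x) (denP y)).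

Definition den1 : {t : A | t \in S} := exist _ 1 (rpred1 S).

Definition loc_add x y : preloc :=
  (num x * den y + num y * den x, denM x y).
Definition loc_opp x : preloc := (- num x, x.2).
Definition loc_mul x y : preloc := (num x * num y, denM x y).
Definition loc_cst (a : A) : preloc := (a, den1).

Definition addl := lift_op2 loc loc_add.
Definition oppl := lift_op1 loc loc_opp.
Definition mull := lift_op2 loc loc_mul.
Definition zerol : loc := lift_cst loc (loc_cst 0).
Definition onel : loc := lift_cst loc (loc_cst 1).

Canonical pi_zerol_morph := PiConst zerol.
Canonical pi_onel_morph := PiConst onel.

Lemma loc_reprP x :
  exists2 u, u \in S &
    u * (num x * den (repr (\pi_loc x))) = u * (num (repr (\pi_loc x)) * den x).
Proof. by have /eqmodP/asboolP := esym (reprK (\pi_loc x)). Qed.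

Lemma pi_addl : {morph \pi_loc : x y / loc_add x y >-> addl x y}.
Proof.
move=> x y; unlock addl; apply/eqmodP/asboolP => /=.
have [u uS e] := loc_reprP x; have [v vS f] := loc_reprP y.
move: (repr _) (repr _) e f => y' x' e f.
exists (u * v); first by rewrite rpredM.
transitivity (v * (den y * den y') * (u * (num x * den x'))
            + u * (den x * den x') * (v * (num y * den y'))); first by ring.
by rewrite e f; ring.
Qed.
Canonical pi_addl_morph := PiMorph2 pi_addl.

Lemma pi_oppl : {morph \pi_loc : x / loc_opp x >-> oppl x}.
Proof.
move=> x; unlock oppl; apply/eqmodP/asboolP => /=.
have [u uS e] := loc_reprP x; exists u => //.
by rewrite !mulNr !mulrN e.
Qed.
Canonical pi_oppl_morph := PiMorph1 pi_oppl.

Lemma pi_mull : {morph \pi_loc : x y / loc_mul x y >-> mull x y}.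
Proof.
move=> x y; unlock mull; apply/eqmodP/asboolP => /=.
have [u uS e] := loc_reprP x; have [v vS f] := loc_reprP y.
move: (repr _) (repr _) e f => y' x' e f.
exists (u * v); first by rewrite rpredM.
transitivity ((u * (num x * den x')) * (v * (num y * den y'))); first by ring.
by rewrite e f; ring.
Qed.
Canonical pi_mull_morph := PiMorph2 pi_mull.

Lemma loc_eqP x y : num x * den y = num y * den x -> \pi_loc x = \pi_loc y.
Proof.
by move=> e; apply/eqmodP/asboolP; exists 1; rewrite ?rpred1 ?e.
Qed.

Lemma addlA : associative addl.
Proof.
elim/quotW=> x; elim/quotW=> y; elim/quotW=> z; rewrite !piE.
by apply: loc_eqP => /=; ring.
Qed.

Lemma addlC : commutative addl.
Proof.
elim/quotW=> x; elim/quotW=> y; rewrite !piE.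
by apply: loc_eqP => /=; ring.
Qed.

Lemma add0l : left_id zerol addl.
Proof. by elim/quotW=> x; rewrite !piE; apply: loc_eqP => /=; ring. Qed.

Lemma addNl : left_inverse zerol oppl addl.
Proof. by elim/quotW=> x; rewrite !piE; apply: loc_eqP => /=; ring. Qed.

HB.instance Definition _ := GRing.isZmodule.Build loc addlA addlC add0l addNl.

Lemma mullA : associative mull.
Proof.
elim/quotW=> x; elim/quotW=> y; elim/quotW=> z; rewrite !piE.
by apply: loc_eqP => /=; ring.
Qed.

Lemma mullC : commutative mull.
Proof.
elim/quotW=> x; elim/quotW=> y; rewrite !piE.
by apply: loc_eqP => /=; ring.
Qed.

Lemma mul1l : left_id onel mull.
Proof. by elim/quotW=> x; rewrite !piE; apply: loc_eqP => /=; ring. Qed.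

Lemma mullDl : left_distributive mull addl.
Proof.
elim/quotW=> x; elim/quotW=> y; elim/quotW=> z; rewrite !piE.
by apply: loc_eqP => /=; ring.
Qed.

HB.instance Definition _ :=
  GRing.Zmodule_isComPzRing.Build loc mullA mullC mul1l mullDl.

(* The fraction a/t. *)
Definition locfrac (a : A) (t : {t : A | t \in S}) : loc := \pi_loc (a, t).

Lemma locfrac_eq a t b s :
  (locfrac a t = locfrac b s) <->
  (exists2 u, u \in S & u * (a * sval s) = u * (b * sval t)).
Proof.
by split=> [/eqmodP/asboolP //|e]; apply/eqmodP/asboolP.
Qed.

Lemma locfrac_eqr a (t : {t : A | t \in S}) b (s : {t : A | t \in S}) :
  a * sval s = b * sval t -> locfrac a t = locfrac b s.
Proof. by move=> e; apply/locfrac_eq; exists 1; rewrite ?rpred1 ?e. Qed.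

Lemma locfracP (x : loc) : exists a t, x = locfrac a t.
Proof. by elim/quotW: x => -[a t]; exists a, t. Qed.

Lemma locfrac0 : 0 = locfrac 0 den1.
Proof. by rewrite [LHS]piE. Qed.

Lemma locfrac1 : 1 = locfrac 1 den1.
Proof. by rewrite [LHS]piE. Qed.

Lemma locfracD a t b s :
  locfrac a t + locfrac b s =
  locfrac (a * sval s + b * sval t) (denM (a, t) (b, s)).
Proof. by rewrite [LHS]piE. Qed.

Lemma locfracM a t b s :
  locfrac a t * locfrac b s = locfrac (a * b) (denM (a, t) (b, s)).
Proof. by rewrite [LHS]piE. Qed.

End Localization.

Definition ideal_gen1 (R : comPzRingType) (d : R) : set R :=
  [set r * d | r in [set: R]].

Definition ideal_gen2 (R : comPzRingType) (a b : R) : set R :=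
  [set x * a + y * b | x in [set: R] & y in [set: R]].

Definition principal (R : comPzRingType) (I : set R) : Prop :=
  exists d, I = ideal_gen1 d.

Definition is_semi_transition (R : comPzRingType) (Lambda : Type)
    (psi : R -> set Lambda) : Prop :=
  [/\ forall a b, psi (a * b) = psi a `|` psi b,
      psi 1 = set0 /\ (forall a, psi a = setT <-> a = 0) &
      forall a b,
        (exists2 c, ideal_gen2 a b c &
           psi a `&` psi b = psi c /\ psi c `<=` psi (a + b)) /\
        (psi a `&` psi b = set0 ->
           exists m n, [/\ (0 < m)%N, (0 < n)%N &
             principal (ideal_gen2 (a ^+ m) (b ^+ n))])].

Record semi_transition (R : comPzRingType) (Lambda : Type) := SemiTransition {
  st_fun :> R -> set Lambda;
  st_nonempty : [set: Lambda] !=set0;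
  st_axioms : is_semi_transition st_fun }.

Section Phi.
Variables (A : comPzRingType) (Lambda : Type) (psi : semi_transition A Lambda).

Lemma stM a b : psi (a * b) = psi a `|` psi b.
Proof. by case: (st_axioms psi). Qed.

Lemma st1 : psi 1 = set0.
Proof. by case: (st_axioms psi) => _ []. Qed.

Lemma st0 : psi 0 = setT.
Proof. by case: (st_axioms psi) => _ [_ /(_ 0)[_]] h _; exact: h. Qed.

(* The multiplicative set S = {a | psi a = set0}; stloc is S^-1 A. *)
Definition stS : {pred A} := fun a => `[< psi a = set0 >].

Lemma stSP a : a \in stS <-> psi a = set0.
Proof. by split=> [/asboolP|h]; last apply/asboolP. Qed.

Lemma stS_closed : mulr_closed stS.
Proof.
split=> [|a b /stSP pa /stSP pb]; apply/stSP; first exact: st1.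
by rewrite stM pa pb setU0.
Qed.

HB.instance Definition _ := GRing.isMulClosed.Build A stS stS_closed.

Definition stloc := loc stS.

HB.instance Definition _ := GRing.ComPzRing.on stloc.

Lemma stloc1_neq0 : 1 != 0 :> stloc.
Proof.
rewrite /stloc locfrac0 locfrac1; apply/eqP => /locfrac_eq[u /stSP uS] /=.
rewrite mul0r !mulr1 mulr0 => u0; have [l _] := st_nonempty psi.
by suff: set0 l by []; rewrite -uS u0 st0.
Qed.

HB.instance Definition _ :=
  GRing.PzSemiRing_isNonZero.Build stloc stloc1_neq0.

(* The map a/t |-> psi a; it is independent of the representative, see phiE. *)
Definition phi (x : stloc) : set Lambda := psi (repr x).1.

Lemma phiE a t : phi (locfrac a t : loc stS) = psi a.
Proof.
rewrite /phi /locfrac.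
have [u uS /= e] := loc_reprP ((a, t) : preloc stS).
move: (repr _) e => -[b s] /= e.
have sS := valP s; have tS := valP t; move/stSP: uS => uS.
move/stSP: sS => sS; move/stSP: tS => tS.
by move: (congr1 psi e); rewrite !stM uS sS tS !set0U !setU0.
Qed.

Lemma phi_is_semi_transition : is_semi_transition phi.
Proof.
have [_ [_ psi0] psiI] := st_axioms psi.
pose i (a : A) : stloc := locfrac a (den1 stS).
have iM a b : i (a * b) = i a * i b.
  by rewrite [RHS]locfracM; apply: locfrac_eqr => /=; ring.
have iD a b : i (a + b) = i a + i b.
  by rewrite [RHS]locfracD; apply: locfrac_eqr => /=; ring.
have i1 : i 1 = 1 by exact: esym (locfrac1 _).
have i0 : i 0 = 0 by exact: esym (locfrac0 _).
have iX a n : i (a ^+ n) = i a ^+ n.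
  by elim: n => [|n IH]; rewrite ?expr0 // !exprS iM IH.
have phii a : phi (i a) = psi a by rewrite phiE.
have fracP (x : stloc) :
    exists a u v, [/\ x = v * i a, i a = i u * x & psi u = set0].
  have [a [t xE]] := locfracP x; exists a, (sval t), (locfrac 1 t).
  split; last by apply/stSP; exact: (svalP t).
    by rewrite xE [RHS]locfracM; apply: locfrac_eqr => /=; ring.
  by rewrite xE [RHS]locfracM; apply: locfrac_eqr => /=; ring.
have phiM x y : phi (x * y) = phi x `|` phi y.
  have [a [t ->]] := locfracP x; have [b [s ->]] := locfracP y.
  by rewrite locfracM !phiE stM.
have phi_frac a u x : i a = i u * x -> psi u = set0 -> phi x = psi a.
  by move=> e u0; rewrite -[RHS]phii e phiM phii u0 set0U.
split=> // [|x y].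
  split=> [|x]; first by rewrite -i1 phii st1.
  have [a [u [v [xE aE u0]]]] := fracP x.
  rewrite (phi_frac _ _ _ aE u0) psi0; split=> [a0|x0].
    by rewrite xE a0 i0 mulr0.
  move: aE; rewrite x0 mulr0 locfrac0 => /locfrac_eq[w /stSP w0 /=].
  rewrite !mulr1 mulr0 => wa0; apply/psi0.
  by rewrite -st0 -wa0 stM w0 set0U.
have [a [u [v [xE aE u0]]]] := fracP x.
have [b [w [z [yE bE w0]]]] := fracP y.
have [[c [p _ [q _ pqc]] [cE _]] prin] := psiI a b.
rewrite (phi_frac _ _ _ aE u0) (phi_frac _ _ _ bE w0); split.
  exists (i c).
    exists (i (p * u)) => //; exists (i (q * w)) => //.
    by rewrite -pqc iD !iM aE bE; ring.
  rewrite phii; split=> //.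
  have abE : i (a * w + b * u) = i (u * w) * (x + y).
    by rewrite iD !iM aE bE; ring.
  rewrite (phi_frac _ _ _ abE) ?stM ?u0 ?w0 ?setU0 //.
  have [[c' _ [c'E sub]] _] := psiI (a * w) (b * u).
  by move: c'E sub; rewrite !stM u0 w0 !setU0 cE => ->.
move=> /prin[m [n [m0 n0 [d dE]]]]; exists m, n; split=> //; exists (i d).
have [e _ am] : ideal_gen1 d (a ^+ m).
  by rewrite -dE; exists 1 => //; exists 0 => //; ring.
have [f _ bn] : ideal_gen1 d (b ^+ n).
  by rewrite -dE; exists 0 => //; exists 1 => //; ring.
have [p' _ [q' _ dab]] : ideal_gen2 (a ^+ m) (b ^+ n) d.
  by rewrite dE; exists 1 => //; rewrite mul1r.
apply/seteqP; split=> [_ [g _ [h _ <-]]|_ [g _ <-]].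
  exists (g * v ^+ m * i e + h * z ^+ n * i f) => //.
  rewrite xE yE !exprMn -!iX -am -bn !iM; ring.
exists (g * i p' * i u ^+ m) => //; exists (g * i q' * i w ^+ n) => //.
by rewrite -dab iD !iM !iX aE bE !exprMn; ring.
Qed.

End Phi.

Arguments phi {A Lambda} psi.

(* idealr_closed includes 1 \notin M, so it describes the proper ideals. *)
Definition maximal_ideal (R : comNzRingType) (M : set R) : Prop :=
  idealr_closed (fun x => x \in M) /\
  forall I : set R, idealr_closed (fun x => x \in I) -> M `<=` I -> I = M.

Section Filters.
Variables (A : comPzRingType) (Lambda : Type) (psi : semi_transition A Lambda).

Definition phi_filter (F : set (set Lambda)) : Prop :=
  [/\ F !=set0 /\ F `<=` range (phi psi),
      ~ F set0,
      forall a b, F (phi psi a) -> F (phi psi b) ->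
        F (phi psi a `&` phi psi b) &
      forall a c, F (phi psi a) -> phi psi a `<=` phi psi c ->
        F (phi psi c)].

Definition phi_ultrafilter (F : set (set Lambda)) : Prop :=
  phi_filter F /\ forall G, phi_filter G -> F `<=` G -> G = F.

End Filters.

(* Main.v *)
(* The maps I |-> phi[I] and F |-> phi^-1[F] are monotone, send proper ideals
   to phi-filters and phi-filters to proper ideals, and satisfy
   phi[phi^-1[F]] = F and I <= phi^-1[phi[I]].  Hence they restrict to mutually
   inverse bijections between the maximal elements on both sides. *)
Require Import Defs.
From HB Require Import structures.
From mathcomp Require Import all_boot all_algebra.
From mathcomp Require Import all_classical.

Local Open Scope classical_set_scope.
Local Open Scope ring_scope.

Import GRing.Theory.

(** Trades boolean membership for plain set membership, so that ideal conditions can be handled as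
    propositions. *)
Lemma idealr_closed_setP (R : comNzRingType) (I : set R) :
  idealr_closed (fun x => x \in I) <->
  [/\ I 0, ~ I 1 & forall a u v, I u -> I v -> I (a * u + v)].
Proof.
split=> [[I0 I1 Ilin]|[I0 I1 Ilin]].
  split; first by apply: set_mem; exact: I0.
    by move=> /mem_set h; move/negP: I1; apply; exact: h.
  by move=> a u v /mem_set Iu /mem_set Iv; apply: set_mem; exact: Ilin.
split; first exact: (mem_set I0).
  by apply/negP => h; apply: I1; exact: (set_mem h).
move=> a u v Iu Iv; apply: mem_set.
by apply: Ilin; [exact: (set_mem Iu)|exact: (set_mem Iv)].
Qed.

Lemma phiM (A : comPzRingType) (Lambda : Type) (psi : semi_transition A Lambda)
  (x y : stloc psi) : phi psi (x * y) = phi psi x `|` phi psi y.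
Proof. by case: (phi_is_semi_transition psi). Qed.

(** If [x] is [a/t], then [psi a] is empty, so [a] is itself an allowed denominator and [t/a]
    inverts [x]. *)
Lemma phi_eq0_inv (A : comPzRingType) (Lambda : Type)
    (psi : semi_transition A Lambda) (x : stloc psi) :
  phi psi x = set0 -> exists y, y * x = 1.
Proof.
have [a [t ->]] := locfracP x; rewrite phiE => /stSP aS.
exists (locfrac (sval t) (exist _ a aS)).
rewrite [LHS]locfracM [RHS]locfrac1; apply: locfrac_eqr => /=.
by rewrite mulr1 mul1r mulrC.
Qed.

(** A proper ideal contains no unit, which keeps the empty set out of the image. *)
Lemma phi_image_filter (A : comPzRingType) (Lambda : Type)
    (psi : semi_transition A Lambda) (I : set (stloc psi)) :
  idealr_closed (fun x => x \in I) -> phi_filter psi (phi psi @` I).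
Proof.
move=> /idealr_closed_setP[I0 I1 Ilin].
have IM r x : I x -> I (r * x) by move=> Ix; rewrite -[_ * _]addr0; exact: Ilin.
have [_ _ phiI] := phi_is_semi_transition psi.
split.
- by split=> [|_ [x _ <-]]; [exists (phi psi 0), 0|exists x].
- by move=> [x Ix /phi_eq0_inv[y yx1]]; apply: I1; rewrite -yx1; exact: IM.
- move=> _ _ [x Ix <-] [y Iy <-].
  (* The intersection is the value of [phi] at some [p * x + q * y], which stays in [I]. *)
  have [[c [p _ [q _ <-]] [-> _]] _] := phiI x y.
  by eexists; last reflexivity; apply: Ilin => //; exact: IM.
(* The value at [c * x] is the union of both values, hence the larger one, [phi psi c]. *)
- move=> _ c [x Ix <-] sub; exists (c * x); first exact: IM.
  by rewrite phiM; apply/setUidPl.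
Qed.

Lemma phi_preimage_ideal (A : comPzRingType) (Lambda : Type)
    (psi : semi_transition A Lambda) (F : set (set Lambda)) :
  phi_filter psi F -> idealr_closed (fun x => x \in phi psi @^-1` F).
Proof.
move=> [[[X FX] Fsub] F0 FI Fup].
have [_ [phi1 phi0] phiI] := phi_is_semi_transition psi.
apply/idealr_closed_setP; split.
(* Any member of [F] lies below [phi psi 0], which is all of [Lambda]. *)
- have [x _ xX] := Fsub _ FX; apply: (Fup x); first by rewrite xX.
  by rewrite (proj2 (phi0 0) erefl).
- by rewrite /preimage /= phi1.
- move=> r x y Fx Fy.
  have Frx : F (phi psi (r * x)).
    by apply: (Fup x) => //; rewrite phiM; exact: subsetUr.
  (* The value at the sum contains the intersection of the two values, a member of [F]. *)
  have [[c _ [cE sub]] _] := phiI (r * x) y.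
  by apply: (Fup c) => //; rewrite -cE; exact: FI.
Qed.

Lemma phi_image_preimage (A : comPzRingType) (Lambda : Type)
    (psi : semi_transition A Lambda) (F : set (set Lambda)) :
  phi_filter psi F -> phi psi @` (phi psi @^-1` F) = F.
Proof.
move=> [[_ Fsub] _ _ _]; apply/seteqP; split; first exact: image_preimage_subset.
by move=> X FX; have [x _ xX] := Fsub _ FX; exists x; rewrite /preimage /= ?xX.
Qed.

Lemma phi_preimage_image (A : comPzRingType) (Lambda : Type)
    (psi : semi_transition A Lambda) (M : set (stloc psi)) :
  maximal_ideal M -> phi psi @^-1` (phi psi @` M) = M.
Proof.
move=> [Mid Mmax]; apply: Mmax; last exact: preimage_image.
exact/phi_preimage_ideal/phi_image_filter.
Qed.

Theorem theorem3p4 (A : comPzRingType) (Lambda : Type)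
    (psi : semi_transition A Lambda) :
  [/\ forall M : set (stloc psi),
        maximal_ideal M -> phi_ultrafilter psi (phi psi @` M),
      forall F : set (set Lambda),
        phi_ultrafilter psi F -> maximal_ideal (phi psi @^-1` F) &
      set_bij [set M : set (stloc psi) | maximal_ideal M]
              [set F : set (set Lambda) | phi_ultrafilter psi F]
              (fun M => phi psi @` M)].
Proof.
have image_ultra (M : set (stloc psi)) :
    maximal_ideal M -> phi_ultrafilter psi (phi psi @` M).
  move=> [Mid Mmax]; split=> [|G Gfil sub]; first exact: phi_image_filter.
  (* The preimage of [G] is a proper ideal containing [M], hence equals [M]; its image is [G]. *)
  rewrite -(Mmax (phi psi @^-1` G)) ?phi_image_preimage //.
    exact: phi_preimage_ideal.
  by move=> x Mx; apply: sub; exists x.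
have preimage_max F :
    phi_ultrafilter psi F -> maximal_ideal (phi psi @^-1` F).
  move=> [Ffil Fmax]; split=> [|I Iid sub]; first exact: phi_preimage_ideal.
  apply/seteqP; split=> // x Ix.
  (* The image of [I] is a filter containing [F], so it may replace [F] in the goal. *)
  rewrite -(Fmax (phi psi @` I)); first by exists x.
    exact: phi_image_filter.
  by rewrite -[X in X `<=` _](phi_image_preimage _ _ _ _ Ffil); exact: image_subset.
split=> //; split=> [M|M N|F Fultra]; first exact: image_ultra.
  move=> /set_mem Mmax /set_mem Nmax eqMN.
  (* Injectivity: a maximal ideal is recovered from its image by taking the preimage. *)
  by rewrite -(phi_preimage_image _ _ _ _ Mmax) eqMN phi_preimage_image.
exists (phi psi @^-1` F); first exact: preimage_max.
by have [Ffil _] := Fultra; exact: phi_image_preimage.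
Qed.
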